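(* Let $\mathcal{A}=(U,\mathcal{C})$ be a convex geometry with $U=\{1,\dots,n\}$, let $\mathcal{R}$ be its set of rooted circuits and $\mathcal{R}_0\subseteq\mathcal{R}$ its set of critical rooted circuits. For a rooted circuit $(C,r)$ put $K(C,r)=\{x\in\mathbb{R}^n : n x_r>\sum_{e\in C\setminus\{r\}}x_e\}$, and let $K(\mathcal{R})=\bigcap_{(C,r)\in\mathcal{R}}K(C,r)$ and $K(\mathcal{R}_0)=\bigcap_{(C,r)\in\mathcal{R}_0}K(C,r)$ (an empty intersection being $\mathbb{R}^n$). Let $\mathcal{H}_n$ denote the set of coordinate hyperplanes of $\mathbb{R}^n$. Then $(\mathcal{H}_n,K(\mathcal{R}))$ and $(\mathcal{H}_n,K(\mathcal{R}_0))$ are both realizations of $\mathcal{A}$, that is, each of the two sets meets the open orthant $\mathcal{O}(X)$ if and only if $X\in\mathcal{C}$ (for every $X\subseteq U$). More generally, let $\mathcal{I}=(U',\mathcal{C}')$ be an ideal of $\mathcal{A}$ and let $\mathcal{P}$ be the set of positive circuits of $\mathcal{I}$ with respect to $\mathcal{A}$. For $P\in\mathcal{P}$ put $K(P)=\{x\in\mathbb{R}^n:\sum_{e\in P}x_e<0\}$, and let $K(\mathcal{P})=\bigcap_{P\in\mathcal{P}}K(P)$, $K=K(\mathcal{R})\cap K(\mathcal{P})$ and $K_0=K(\mathcal{R}_0)\cap K(\mathcal{P})$. Then $(\mathcal{H}_n,K)$ and $(\mathcal{H}_n,K_0)$ are both realizations of $\mathcal{I}$, that is, each of $K$ and $K_0$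 meets $\mathcal{O}(X)$ if and only if $X\in\mathcal{C}'$ (for every $X\subseteq U$).
   Context: A convex geometry is a pair $(U,\mathcal{C})$ with $U$ a finite set and $\mathcal{C}\subseteq 2^U$ such that (C1) $\varnothing,U\in\mathcal{C}$; (C2) $X\cap Y\in\mathcal{C}$ for all $X,Y\in\mathcal{C}$; (C3) for every $X\in\mathcal{C}\setminus\{U\}$ there is $e\in U\setminus X$ with $X\cup\{e\}\in\mathcal{C}$. The convex hull $\mathrm{conv}(A)$ of $A\subseteq U$ is the intersection of all members of $\mathcal{C}$ containing $A$. For $\mathcal{S}\subseteq 2^U$ and $Y\subseteq U$, the trace is $\mathcal{S}|_Y=\{X\cap Y:X\in\mathcal{S}\}$. A rooted set is a pair $(C,r)$ with $C\subseteq U$, $r\in C$. A rooted set $(C,r)$ is a rooted circuit of $(U,\mathcal{C})$ if $\mathcal{C}|_C=2^C\setminus\{C\setminus\{r\}\}$. A rooted circuit $(C,r)$ is critical if $\mathrm{conv}(C)\setminus\{r\}\notin\mathcal{C}$ but $\mathrm{conv}(C)\setminus\{r,b\}\in\mathcal{C}$ for every $b\in C\setminus\{r\}$. An ideal of the convex geometry $(U,\mathcal{C})$ is a pair $(U',\mathcal{C}')$ with $U'\subseteq U$, $\mathcal{C}'\subseteq\mathcal{C}$, $\mathcal{C}'\subseteq 2^{U'}$, such that $X\in\mathcal{C}$, $Y\in\mathcal{C}'$, $X\subseteq Y$ imply $X\in\mathcal{C}'$. A positive circuit of the ideal with respect to $(U,\mathcal{C})$ is a set $P\subseteq U$ with $\mathcal{C}'|_P=2^P\setminus\{P\}$.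 For $X\subseteq U=\{1,\dots,n\}$, the open $X$-orthant is $\mathcal{O}(X)=\{x\in\mathbb{R}^n: x_e>0\text{ for }e\in X,\ x_e<0\text{ for }e\notin X\}$. For an open convex set $K\subseteq\mathbb{R}^n$, the pair $(\mathcal{H}_n,K)$ is a realization of a family $\mathcal{S}\subseteq 2^U$ if $\mathcal{S}=\{X\subseteq U:\mathcal{O}(X)\cap K\neq\varnothing\}$. *)

(* Defs.v *)
From mathcomp Require Import all_boot all_order all_algebra.
From mathcomp Require Import all_classical all_reals all_analysis.

Set Implicit Arguments.
Unset Strict Implicit.
Unset Printing Implicit Defensive.

Import Order.TTheory GRing.Theory Num.Theory.
Import numFieldNormedType.Exports.

(* The ground set U is the whole finite type T; a set system on U is an element
   of {set {set T}}. *)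

Section Combinatorics.
Variable T : finType.
Implicit Types (C S : {set {set T}}) (A P Y : {set T}).
Implicit Type Cr : {set T} * T.

Definition convex_geometry C : Prop :=
  [/\ finset.set0 \in C /\ [set: T]%SET \in C,
      forall X Y : {set T}, X \in C -> Y \in C -> X :&: Y \in C
    & forall X : {set T}, X \in C -> X != [set: T]%SET ->
        exists2 e : T, e \notin X & e |: X \in C].

Definition conv_hull C A : {set T} := (\bigcap_(X in C | A \subset X) X)%SET.

Definition trace_on S Y : {set {set T}} := [set X :&: Y | X in S]%SET.

Definition rooted_circuit C Cr : bool :=
  (Cr.2 \in Cr.1) &&
  (trace_on C Cr.1 == powerset Cr.1 :\ (Cr.1 :\ Cr.2)).

Definition critical_circuit C Cr : bool :=
  [&& rooted_circuit C Cr,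
      conv_hull C Cr.1 :\ Cr.2 \notin C
    & [forall b in Cr.1 :\ Cr.2,
        (conv_hull C Cr.1 :\: [set Cr.2; b]%SET) \in C]].

Definition rooted_circuits C : {set {set T} * T} :=
  [set Cr | rooted_circuit C Cr]%SET.

Definition critical_circuits C : {set {set T} * T} :=
  [set Cr | critical_circuit C Cr]%SET.

(* No nonemptiness is required: C' may be empty. *)
Definition ideal C (U' : {set T}) (C' : {set {set T}}) : Prop :=
  [/\ C' \subset C, C' \subset powerset U'
    & forall X Y : {set T}, X \in C -> Y \in C' -> X \subset Y -> X \in C'].

Definition positive_circuits (C' : {set {set T}}) : {set {set T}} :=
  [set P | trace_on C' P == powerset P :\ P]%SET.

End Combinatorics.

Local Open Scope classical_set_scope.
Local Open Scope ring_scope.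

Section Realization.
Variables (R : realType) (n : nat).

Definition orthant (X : {set 'I_n}) : set 'rV[R]_n :=
  [set x : 'rV[R]_n | forall e : 'I_n, if e \in X then 0 < x 0 e else x 0 e < 0].

(* The arrangement is always that of the coordinate hyperplanes, whose regions
   are the open orthants, so it is not a parameter. *)
Definition realization (K : set 'rV[R]_n) (S : {set {set 'I_n}}) : Prop :=
  [/\ open K, convex_set (K : set (convex_lmodType 'rV[R]_n))
    & forall X : {set 'I_n}, X \in S <-> orthant X `&` K !=set0].

Definition circuit_halfspace (Cr : {set 'I_n} * 'I_n) : set 'rV[R]_n :=
  [set x : 'rV[R]_n | n%:R * x 0 Cr.2 > \sum_(e in Cr.1 :\ Cr.2) x 0 e].

Definition circuits_cone (Q : {set {set 'I_n} * 'I_n}) : set 'rV[R]_n :=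
  \bigcap_(Cr in [set` Q]) circuit_halfspace Cr.

Definition positive_halfspace (P : {set 'I_n}) : set 'rV[R]_n :=
  [set x : 'rV[R]_n | \sum_(e in P) x 0 e < 0].

Definition positive_cone (Q : {set {set 'I_n}}) : set 'rV[R]_n :=
  \bigcap_(P in [set` Q]) positive_halfspace P.

End Realization.

Arguments circuits_cone R {n} Q _.
Arguments positive_cone R {n} Q _.

(* Main.v *)
(** If [X] is convex, adding elements one at a time leads from [X] to the ground
    set through convex sets; coordinates equal to [1] on [X] and negative of
    geometrically growing size along this chain satisfy all inequalities.
    Conversely, suppose that [x] lies in the orthant of a non-convex set [X].
    It need not violate the inequality of a critical circuit [(S, r)] with
    [S :\ r \subset X], since there may be none; but if [x r] is minimal over
    [conv X :\: X], then a minimal convex subset of [conv X] in which [r] is not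
    extreme yields a critical circuit rooted at [r] whose coordinates are all at
    least [x r], and [n * x r <= #|S :\ r| * x r] contradicts its inequality.
    For an ideal, a set contained in none of its members contains a positive
    circuit, on which the positive coordinates cannot have a negative sum. *)

Require Import Defs.
From mathcomp Require Import all_boot all_order all_algebra.
From mathcomp Require Import all_classical all_reals all_analysis.
From mathcomp Require Import ring lra.

Set Implicit Arguments.
Unset Strict Implicit.
Unset Printing Implicit Defensive.

Import Order.TTheory GRing.Theory Num.Theory.
Import numFieldNormedType.Exports.

Local Open Scope classical_set_scope.

(** * Extreme points, critical circuits, shellings and positive circuits *)

Section ConvexGeometry.
Variables (T : finType) (C : {set {set T}}).
Hypothesis hC : convex_geometry C.
Implicit Types (X Y Z A S P : {set T}).

(** Take a maximal convex [W] with trace [X] on [Y]. The element that augments [W] must lie in [Y],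
    since otherwise the trace would be unchanged; intersecting with [Y] then augments [X]. *)
Lemma convex_geometry_augment X Y : X \in C -> Y \in C -> X \proper Y ->
  exists2 e, e \in Y :\: X & e |: X \in C.
Proof.
have [_ CI Caug] := hC.
move=> XC YC XY; have sXY := proper_sub XY.
have PX : (X \in C) && (X :&: Y == X) by rewrite XC; apply/eqP/finset.setIidPl.
have [W /maxsetP[/andP[WC /eqP WY] Wmax] XW] :=
  maxset_exists (P := fun W => (W \in C) && (W :&: Y == X)) PX.
have WT : W != [set: T]%SET.
  by apply: contraTneq XY => WT; rewrite -WY WT finset.setTI fintype.properxx.
have [e eW eWC] := Caug W WC WT.
have eY : e \in Y.
  apply: contraNT eW => eY.
  rewrite -[in X in _ \in X](Wmax (e |: W)%SET) ?finset.setU11 //.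
    rewrite eWC /=; apply/eqP/finset.setP => x; rewrite -WY !inE.
    by case: eqVneq => // ->; rewrite (negPf eY) !andbF.
  exact: finset.subsetUr.
exists e; first by rewrite !inE eY andbT -WY inE (negPf eW).
suff -> : (e |: X = (e |: W) :&: Y)%SET by exact: CI.
apply/finset.setP => x; rewrite -WY !inE; case: eqVneq => //= ->.
by rewrite eY.
Qed.

(** A maximal convex proper subset of [Y] above [X] can be augmented inside [Y], and by maximality
    the result is [Y] itself. *)
Lemma convex_geometry_coatom X Y : X \in C -> Y \in C -> X \proper Y ->
  exists2 b, b \in Y :\: X & Y :\ b \in C.
Proof.
move=> XC YC XY.
have PX : (X \in C) && (X \proper Y) by rewrite XC.
have [V /maxsetP[/andP[VC VY] Vmax] XV] :=
  maxset_exists (P := fun V => (V \in C) && (V \proper Y)) PX.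
have [e] := convex_geometry_augment VC YC VY.
rewrite inE => /andP[eV eY] eVC.
exists e; first by rewrite inE eY andbT; apply: contraNN eV; exact: fintype.subsetP.
have sVY : (e |: V)%SET \subset Y.
  by rewrite finset.subUset finset.sub1set eY proper_sub.
have eVY : (e |: V = Y)%SET.
  apply/eqP; rewrite eqEproper sVY; apply/negP => eVY.
  move: eV; rewrite -(Vmax (e |: V)%SET) ?eVC ?eVY ?finset.subsetUr //.
  by rewrite finset.setU11.
by rewrite -eVY finset.setU1K.
Qed.

Lemma conv_hull_convex A : conv_hull C A \in C.
Proof.
have [[_ CT] CI _] := hC.
by rewrite /conv_hull; elim/big_ind: _ => // X /andP[].
Qed.

Lemma sub_conv_hull A : A \subset conv_hull C A.
Proof. by apply/bigcapsP => X /andP[]. Qed.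

Lemma conv_hull_min A X : X \in C -> A \subset X -> conv_hull C A \subset X.
Proof. by move=> XC AX; apply: (finset.bigcap_inf X); rewrite XC. Qed.

Lemma rooted_circuit_trace Cr Z : rooted_circuit C Cr -> Z \in C ->
  Z :&: Cr.1 != Cr.1 :\ Cr.2.
Proof.
case/andP => _ /eqP tr ZC.
have : Z :&: Cr.1 \in trace_on C Cr.1 by exact: imset_f.
by rewrite tr !inE => /andP[].
Qed.

(* The circuit is the set of extreme points of [Y] together with [r], where [Y]
   is a minimal convex set in which [r] is not extreme. *)
Lemma critical_circuit_sub X r : X \in C -> r \in X -> X :\ r \notin C ->
  exists2 S, critical_circuit C (S, r) & S \subset X.
Proof.
have [_ CI _] := hC.
move=> XC rX rXC.
have PX : [&& X \in C, r \in X & X :\ r \notin C] by apply/and3P.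
have [Y /minsetP[/and3P[YC rY rYC] Ymin] YX] :=
  minset_exists (P := fun Y => [&& Y \in C, r \in Y & Y :\ r \notin C]) PX.
pose E := [set b in Y | Y :\ b \in C]%SET.
have EY : E \subset Y by apply/fintype.subsetP => b; rewrite inE => /andP[].
have rE : r \notin E by rewrite inE (negPf rYC) andbF.
(* The extreme points span [Y]: a proper convex subset of [Y] lies in some convex [Y :\ b], and so
   misses the extreme point [b]. *)
have Ehull Z : Z \in C -> E \subset Z -> Y \subset Z.
  move=> ZC EZ; apply/negPn/negP => nYZ.
  have pr : Z :&: Y \proper Y.
    by rewrite finset.properEneq finset.subsetIr andbT; apply: contraNneq nYZ => <-;
       exact: finset.subsetIl.
  have [b] := convex_geometry_coatom (CI _ _ ZC YC) YC pr.
  rewrite !inE => /andP[bZY bY] YbC; move: bZY.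
  by rewrite bY andbT (fintype.subsetP EZ) // inE bY.
(* [Y :\ b] is convex, contains [r] and is smaller than [Y], so by minimality [r] is extreme in
   it. *)
have Er b : b \in E -> Y :\: [set r; b]%SET \in C.
  rewrite inE => /andP[bY YbC]; rewrite finset.setUC -finset.setDDl.
  have nbr : r != b by apply: contraNneq rYC => ->.
  apply/negPn/negP => bad; have := Ymin (Y :\ b).
  rewrite YbC bad !inE nbr rY => /(_ isT (finset.subD1set _ _)) /finset.setP /(_ b).
  by rewrite !inE eqxx bY.
have hull : conv_hull C (r |: E) = Y.
  apply/eqP; rewrite finset.eqEsubset; apply/andP; split.
    by apply: conv_hull_min => //; rewrite finset.subUset finset.sub1set rY.
  apply: Ehull; first exact: conv_hull_convex.
  exact: fintype.subset_trans (finset.subsetUr _ _) (sub_conv_hull _).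
exists (r |: E)%SET; last first.
  by rewrite finset.subUset finset.sub1set rX (fintype.subset_trans EY).
apply/and3P; rewrite hull; split => //; last first.
  by apply/forall_inP => b; rewrite /= finset.setU1K //; exact: Er.
apply/andP; split; first exact: finset.setU11.
rewrite /= finset.setU1K //; apply/eqP/finset.setP => D; rewrite !inE.
apply/imsetP/andP => [[Z ZC ->]|[DE DS]].
  split; last exact: finset.subsetIr.
  apply: contraNneq rE => ZE.
  have /fintype.subsetP /(_ r rY) rZ : Y \subset Z.
    by apply: Ehull => //; rewrite -ZE finset.subsetIl.
  by rewrite -ZE !inE eqxx rZ.
(* The intersection removes from [Y] the extreme points outside [D]. If [r] must go too, it goes
   along with any such point, and one exists because [D] is not [E]. *)
pose Z := (Y :&: \bigcap_(b in E :\: D)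
             if r \in D then Y :\ b else Y :\: [set r; b])%SET.
exists Z.
  rewrite /Z; elim/big_rec: _ => [|b A]; first by rewrite finset.setIT.
  rewrite inE => /andP[_ bE] AC; rewrite finset.setICA; apply: CI => //.
  by case: ifP => _; [move: bE; rewrite inE => /andP[]|exact: Er].
apply/finset.setP => x; apply/idP/idP => [xD|].
  have xS := fintype.subsetP DS x xD.
  have xY : x \in Y.
    by move: xS; rewrite !inE => /orP[/eqP->//|/andP[]].
  rewrite 2!inE xS xY /= andbT; apply/bigcapP => b; rewrite inE => /andP[bD bE].
  have xb : x != b by apply: contraNneq bD => <-.
  case: ifPn => rD; rewrite !inE xY andbT ?negb_or xb // andbT.
  by apply: contraNneq rD => <-.
rewrite 3!inE => /andP[/andP[xY /bigcapP xZ]].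
have [|rD] := boolP (r \in D).
  move=> rD /orP[/set1P->//|xE]; apply/negPn/negP => xD.
  have := xZ x; rewrite rD inE xD xE => /(_ isT).
  by rewrite !inE eqxx.
have DE' : D \proper E.
  rewrite finset.properEneq DE; apply/fintype.subsetP => y yD.
  have := fintype.subsetP DS y yD; rewrite !inE => /orP[/eqP yr|//].
  by rewrite -yr yD in rD.
have [_ [b bE bD]] := properP DE'.
move=> /orP[/set1P xr|xE].
  have := xZ b; rewrite (negPf rD) inE bD bE => /(_ isT).
  by rewrite xr !inE eqxx.
apply/negPn/negP => xD; have := xZ x; rewrite (negPf rD) inE xD xE => /(_ isT).
by rewrite !inE eqxx orbT.
Qed.

(* [f] ranks the elements outside [X] along a maximal chain of convex sets from
   [X] to the ground set. *)
Lemma shelling_rank X : X \in C ->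
  exists f : T -> nat, {in [predC X] &, injective f} /\
    forall k, X :|: [set e | f e < k]%N%SET \in C.
Proof.
have [_ _ Caug] := hC.
elim: {X}_.+1 {-2}X (ltnSn #|(~: X)%SET|) => // m IHm X Xm XC.
have [->|XT] := eqVneq X [set: T]%SET.
  exists (fun=> 0%N); split=> [x y|k]; first by rewrite !inE.
  by have [[_ ?] _ _] := hC; rewrite finset.setTU.
have [e eX eXC] := Caug X XC XT.
have [|f [finj fC]] := IHm (e |: X)%SET _ eXC.
  move: Xm; rewrite ltnS; apply: leq_trans; apply: proper_card.
  by rewrite finset.properC finset.properUr // finset.sub1set.
(* The first added element gets rank 0 and the chain of [e |: X] is shifted up by one; level 0 is
   [X] itself. *)
exists (fun x => if x == e then 0%N else (f x).+1); split=> [x y|[|k]].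
- rewrite !inE => xX yX; case: (eqVneq x e) (eqVneq y e) => [->|xe] [->|ye] //.
  by case=> /finj; apply; rewrite !inE negb_or ?xe ?ye.
- suff -> : (X :|: [set x | (if x == e then 0 else (f x).+1) < 0]%N = X)%SET by [].
  by apply/finset.setP => x; rewrite !inE orbF.
- suff -> : (X :|: [set x | (if x == e then 0 else (f x).+1) < k.+1]%N =
      (e |: X) :|: [set x | f x < k]%N)%SET by [].
  apply/finset.setP => x; rewrite !inE; case: eqVneq => //=.
  by rewrite orbT.
Qed.

(** A minimal subset [P] of [X] contained in no member of [C'] works: minimality makes every
    [P :\ p] a trace, and [C'] is closed under intersection, so all proper subsets of [P] are
    traces. *)
Lemma positive_circuit_sub (U' : {set T}) (C' : {set {set T}}) X :
  ideal C U' C' -> (forall Y, Y \in C' -> ~~ (X \subset Y)) ->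
  exists2 P, P \in positive_circuits C' & P \subset X.
Proof.
have [_ CI _] := hC.
move=> [C'C _ C'down] nX.
have PX : [forall Y in C', ~~ (X \subset Y)] by apply/forall_inP.
have [P /minsetP[/forall_inP Pn Pmin] sPX] :=
  minset_exists (P := fun P : {set T} => [forall Y in C', ~~ (P \subset Y)]) PX.
exists P => //; rewrite inE; apply/eqP/finset.setP => Q; rewrite !inE.
have C'I Y Z : Y \in C' -> Z \in C' -> Y :&: Z \in C'.
  move=> YC ZC; apply: (C'down _ Y) => //; last exact: finset.subsetIl.
  by apply: CI; exact: (fintype.subsetP C'C).
have Pp p : p \in P -> exists2 Y, Y \in C' & Y :&: P = P :\ p.
  move=> pP; have : ~~ [forall Y in C', ~~ (P :\ p \subset Y)].
    apply/negP => bad; have := Pmin _ bad (finset.subD1set _ _).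
    by move=> /finset.setP /(_ p); rewrite !inE eqxx pP.
  rewrite negb_forall_in => /exists_inP[Y YC /negPn PY]; exists Y => //.
  apply/finset.setP => x; have := Pn _ YC; rewrite !inE.
  case: (eqVneq x p) => [-> /=|xp _].
    rewrite pP andbT; apply: contraNF => pY.
    by rewrite -(finset.setD1K pP) finset.subUset finset.sub1set pY.
  rewrite andb_idl // => xP; apply: (fintype.subsetP PY).
  by rewrite !inE xp.
apply/imsetP/andP => [[Y YC ->]|[QP sQP]].
  split; last exact: finset.subsetIr.
  by apply: contra (Pn _ YC) => /eqP <-; exact: finset.subsetIl.
have /properP[_ [p pP pQ]] : Q \proper P by rewrite finset.properEneq QP.
suff [Y YC YQ] : exists2 Y, Y \in C' & Y :&: P = Q by exists Y.
(* Induction on the number of missing points: [Q] is the intersection of [p |: Q] and [P :\ p]. *)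
elim: {pP QP}_.+1 {-2}Q (ltnSn #|P :\: Q|) sQP p pP pQ => //.
move=> m IHm {}Q Qm sQP p pP pQ.
have sQ'P : (p |: Q)%SET \subset P by rewrite finset.subUset finset.sub1set pP.
have [Y YC YP] := Pp p pP.
have [Q'P|] := eqVneq (p |: Q)%SET P.
  by exists Y => //; rewrite YP -Q'P finset.setU1K.
move=> Q'P.
have /properP[_ [q qP qQ]] : (p |: Q)%SET \proper P by rewrite finset.properEneq Q'P.
have [|Z ZC ZP] := IHm (p |: Q)%SET _ sQ'P q qP qQ.
  move: Qm; rewrite ltnS; apply: leq_trans; apply: proper_card; apply/properP.
  split; first by apply: finset.setDS; exact: finset.subsetUr.
  by exists p; rewrite !inE ?eqxx // pP pQ.
exists (Y :&: Z); first exact: C'I.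
rewrite -(finset.setIid P) finset.setIACA YP ZP.
apply/finset.setP => x; rewrite !inE; case: eqVneq => [->|_] /=.
  by rewrite (negPf pQ).
by rewrite andb_idl //; exact: fintype.subsetP.
Qed.

End ConvexGeometry.

(** * Openness and convexity of the cones *)

Section RealHalfspaces.
Local Open Scope ring_scope.

Lemma open_bigcap_fin (T : topologicalType) (I : finType) (D : set I)
    (F : I -> set T) :
  (forall i, open (F i)) -> open (\bigcap_(i in D) F i).
Proof.
move=> Fo; rewrite openE => x xF; rewrite /interior /=.
have H : \forall y \near x, forall i, D i -> F i y.
  apply: filter_forall => i; have [Di|nDi] := pselect (D i).
    have : nbhs x (F i) by apply: open_nbhs_nbhs; split; [exact: Fo|exact: xF].
    by apply: filterS => y Fy _.
  by apply: nearW => y /nDi.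
by apply: filterS H => y yF i Di; exact: yF.
Qed.

Lemma convex_set_bigcap (R : numDomainType) (M : lmodType R) (I : Type)
    (D : set I) (F : I -> set (convex_lmodType M)) :
  (forall i, convex_set (F i)) -> convex_set (\bigcap_(i in D) F i).
Proof.
move=> Fc x y l; rewrite !inE => xF yF i Di.
by apply/set_mem; apply: Fc; rewrite inE; [exact: xF|exact: yF].
Qed.

Section Cones.
Variables (R : realType) (n : nat).
Implicit Types (a : 'I_n -> R) (x : 'rV[R]_n) (S X P : {set 'I_n}).

(** Both kinds of half-spaces are rewritten below in this normal form, so that openness and
    convexity are proved only once. *)
Lemma open_halfspace a : open [set x : 'rV[R]_n | 0 < \sum_e a e * x 0 e].
Proof.
have Lc (s : seq 'I_n) : continuous (fun x : 'rV[R]_n => \sum_(e <- s) a e * x 0 e).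
  elim: s => [|e s IHs] x.
    by under eq_fun do rewrite big_nil; exact: (@cst_continuous _ R 0 x).
  under eq_fun do rewrite big_cons.
  apply: (@continuousD _ R^o _ (fun x : 'rV[R]_n => a e * x 0 e)); last exact: IHs.
  apply: continuousM; first exact: cst_continuous.
  exact: coord_continuous.
apply: (@open_comp _ _ (fun x : 'rV[R]_n => \sum_e a e * x 0 e) [set t | 0 < t]).
  by move=> x _; exact: Lc.
exact: open_gt.
Qed.

Lemma convex_halfspace a :
  convex_set ([set x : 'rV[R]_n | 0 < \sum_e a e * x 0 e]
    : set (convex_lmodType 'rV[R]_n)).
Proof.
apply/convex_setW => x y; rewrite !inE /= => x0 y0 k k0 k1; rewrite inE /=.
have -> : \sum_e a e * (conv k x y : 'rV[R]_n) 0 e =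
    k%:num * (\sum_e a e * x 0 e) + (1 - k%:num) * (\sum_e a e * y 0 e).
  rewrite !mulr_sumr -big_split; apply: eq_bigr => e _.
  by rewrite !mxE /= /unstable.onem; ring.
by apply: addr_gt0; apply: mulr_gt0 => //; rewrite subr_gt0.
Qed.

Lemma circuit_halfspaceE (Cr : {set 'I_n} * 'I_n) :
  circuit_halfspace Cr = [set x : 'rV[R]_n |
    0 < \sum_e ((e == Cr.2)%:R * n%:R - (e \in Cr.1 :\ Cr.2)%:R) * x 0 e].
Proof.
have E x : \sum_e ((e == Cr.2)%:R * n%:R - (e \in Cr.1 :\ Cr.2)%:R) * x 0 e =
    n%:R * x 0 Cr.2 - \sum_(e in Cr.1 :\ Cr.2) x 0 e.
  under eq_bigr do rewrite mulrBl.
  rewrite sumrB; congr (_ - _).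
    rewrite (bigD1 Cr.2) //= eqxx mul1r big1 ?addr0 // => e /negPf ->.
    by rewrite !mul0r.
  rewrite [RHS]big_mkcond; apply: eq_bigr => e _.
  by case: ifP => _; rewrite ?mul1r ?mul0r.
by apply/seteqP; split=> x; rewrite /circuit_halfspace /= E subr_gt0.
Qed.

Lemma positive_halfspaceE P :
  positive_halfspace P = [set x : 'rV[R]_n | 0 < \sum_e - (e \in P)%:R * x 0 e].
Proof.
have E x : \sum_e - (e \in P)%:R * x 0 e = - \sum_(e in P) x 0 e.
  rewrite -sumrN [RHS]big_mkcond; apply: eq_bigr => e _.
  by case: ifP => _; rewrite ?mulN1r ?oppr0 ?mul0r.
by apply/seteqP; split=> x; rewrite /positive_halfspace /= E oppr_gt0.
Qed.

Lemma open_circuits_cone (Q : {set {set 'I_n} * 'I_n}) :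
  open (circuits_cone R Q).
Proof.
by apply: open_bigcap_fin => Cr; rewrite circuit_halfspaceE; exact: open_halfspace.
Qed.

Lemma convex_circuits_cone (Q : {set {set 'I_n} * 'I_n}) :
  convex_set (circuits_cone R Q : set (convex_lmodType 'rV[R]_n)).
Proof.
apply: convex_set_bigcap => Cr; rewrite circuit_halfspaceE.
exact: convex_halfspace.
Qed.

Lemma open_positive_cone (Q : {set {set 'I_n}}) : open (positive_cone R Q).
Proof.
by apply: open_bigcap_fin => P; rewrite positive_halfspaceE; exact: open_halfspace.
Qed.

Lemma convex_positive_cone (Q : {set {set 'I_n}}) :
  convex_set (positive_cone R Q : set (convex_lmodType 'rV[R]_n)).
Proof.
apply: convex_set_bigcap => P; rewrite positive_halfspaceE.
exact: convex_halfspace.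
Qed.

(** * Orthants met by the cones *)

Variable C : {set {set 'I_n}}.
Hypothesis hC : convex_geometry C.

Lemma circuits_cone_critical :
  circuits_cone R (rooted_circuits C) `<=` circuits_cone R (critical_circuits C).
Proof.
by move=> x xK Cr; rewrite /= inE => /and3P[Cr' _ _]; apply: xK; rewrite /= inE.
Qed.

(* The coordinates outside [X] are negative and decrease geometrically along the
   rank [f]; since the element of largest rank of a circuit [(S, r)] with
   [r \notin X] is not [r], it dominates the sum. *)
Lemma orthant_circuits_cone X : X \in C -> exists x : 'rV[R]_n,
  [/\ orthant X x, circuits_cone R (rooted_circuits C) x
    & forall P, ~~ (P \subset X) -> \sum_(e in P) x 0 e < 0].
Proof.
move=> XC; have [f [finj fC]] := shelling_rank hC XC.
(* With [m] the size of the coordinate at [r], a sum containing a coordinate of higher rank is at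
   most [N - M * m]; this is below [- N * m] because [N < (N + 1) * m] for [m >= 1]. *)
pose N : R := n%:R; pose M : R := N + N + 1.
have N0 : 0 <= N by exact: ler0n.
have M1 : 1 <= M by rewrite /M; lra.
(* The shifted exponent makes even the coordinate of rank 0 at most [- M], which outweighs up to [n]
   coordinates equal to 1. *)
pose x : 'rV[R]_n := \row_e (if e \in X then 1 else - M ^+ (f e).+1).
have MX k : 1 <= M ^+ k by exact: exprn_ege1.
have x1 e : x 0 e <= 1.
  by rewrite mxE; case: ifP => // _; have := MX (f e).+1; lra.
have sum_card S : \sum_(e in S) x 0 e <= #|S|%:R.
  by rewrite -sum1_card natr_sum; apply: ler_sum => e _; exact: x1.
have sum_le S e : e \in S -> e \notin X -> \sum_(e in S) x 0 e <= N - M ^+ (f e).+1.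
  move=> eS eX; rewrite (big_setD1 e) //= [x 0 e]mxE (negPf eX) addrC lerD2r.
  apply: le_trans (sum_card _) _; rewrite ler_nat.
  by rewrite -[leqRHS]card_ord max_card.
exists x; split.
- move=> e; case: ifPn => [|/negPf] eX; rewrite mxE eX //.
  by rewrite oppr_lt0 (lt_le_trans _ (MX _)).
- move=> [S r]; rewrite /= inE => circ; rewrite /circuit_halfspace /=.
  have /andP[rS _] := circ; rewrite /= in rS.
  have [rX|rX] := boolP (r \in X).
    rewrite [x 0 r]mxE rX mulr1; apply: le_lt_trans (sum_card _) _.
    rewrite ltr_nat; apply: (@leq_trans #|S|); first by rewrite (cardsD1 r S) rS.
    by rewrite -[leqRHS]card_ord max_card.
  (* This convex set misses [r], and its trace on [S] is not [S :\ r]; hence some other element of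
     [S] lies outside it and has rank above that of [r]. *)
  pose Z := (X :|: [set e | f e < f r]%N)%SET.
  have := rooted_circuit_trace circ (fC (f r)); rewrite /= => ZS.
  have [e] : exists e, (e \in S :\ r) && (e \notin Z).
    apply/existsP; rewrite -negb_forall_in; apply: contra ZS => /forall_inP sZ.
    apply/eqP/finset.setP => e; apply/idP/idP.
      rewrite inE => /andP[eZ eS]; rewrite !inE eS andbT.
      by apply: contraTneq eZ => ->; rewrite !inE ltnn orbF.
    by move=> eS; rewrite inE sZ //; move: eS; rewrite inE => /andP[].
  rewrite !inE negb_or -leqNgt => /andP[/andP[er eS] /andP[eX fre]].
  have fr : (f r < f e)%N.
    by rewrite ltn_neqAle fre andbT; apply: contra er => /eqP /finj ->; rewrite ?inE.
  apply: le_lt_trans (sum_le _ e _ eX) _; first by rewrite !inE er eS.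
  rewrite [x 0 r]mxE (negPf rX).
  have : M ^+ (f r).+2 <= M ^+ (f e).+1 by rewrite ler_weXn2l.
  rewrite [M ^+ (f r).+2]exprS; move: (M ^+ (f e).+1) => me.
  have := MX (f r).+1; move: (M ^+ (f r).+1) => m m1 Mm.
  have Nm : N <= N * m by rewrite ler_peMr.
  rewrite mulrN; move: Mm; rewrite /M !mulrDl mul1r -/N; lra.
- move=> P /fintype.subsetPn[e eP eX]; apply: le_lt_trans (sum_le _ _ eP eX) _.
  have : M <= M ^+ (f e).+1 by rewrite exprS ler_peMr //; lra.
  rewrite /M; lra.
Qed.

(* Among the elements added by the convex hull of [X], one with the least
   coordinate is the root of a critical circuit lying in that hull, and it
   violates the inequality of this circuit. *)
Lemma critical_cone_orthant X x :
  orthant X x -> circuits_cone R (critical_circuits C) x -> X \in C.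
Proof.
move=> xX xK; apply/negPn/negP => XC.
pose Y := conv_hull C X; have YC : Y \in C := conv_hull_convex hC X.
have XY : X \subset Y := sub_conv_hull C X.
have /properP[_ [r0 r0Y r0X]] : X \proper Y.
  by rewrite finset.properEneq XY andbT; apply: contraNneq XC => ->.
have Pr0 : (r0 \in Y) && (r0 \notin X) by rewrite r0Y.
case: (arg_minP (P := fun e => (e \in Y) && (e \notin X)) (x 0) Pr0).
move=> r /andP[rY rX] rmin.
have YrC : Y :\ r \notin C.
  apply/negP => YrC.
  have /fintype.subsetP /(_ r rY) : Y \subset Y :\ r.
    by apply: conv_hull_min => //; rewrite finset.subsetD1 XY.
  by rewrite !inE eqxx.
have [S circ SY] := critical_circuit_sub hC YC rY YrC.
have := xK (S, r); rewrite /= inE circ => /(_ isT).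
rewrite /circuit_halfspace /=; apply/negP; rewrite -leNgt.
have xr : x 0 r < 0 by have := xX r; rewrite (negPf rX).
have rS : r \in S by have /and3P[/andP[]] := circ.
(* Since [x 0 r] is negative, replacing the factor [n] by a smaller cardinality increases the
   product. *)
apply: (@le_trans _ _ (#|S :\ r|%:R * x 0 r)).
  rewrite ler_nM2r // ler_nat -[leqRHS]card_ord; exact: max_card.
rewrite mulr_natl -sumr_const; apply: ler_sum => e; rewrite inE => /andP[_ eS].
have [eX|eX] := boolP (e \in X).
  by have := xX e; rewrite eX => /ltW; apply: le_trans; exact: ltW.
by apply: rmin; rewrite eX (fintype.subsetP SY).
Qed.

End Cones.

Lemma convex_setI (R : numDomainType) (M : lmodType R)
    (A B : set (convex_lmodType M)) :
  convex_set A -> convex_set B -> convex_set (A `&` B).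
Proof.
move=> cA cB x y l; rewrite !inE => -[Ax Bx] [Ay By].
by split; apply/set_mem; [apply: cA|apply: cB]; rewrite inE.
Qed.

End RealHalfspaces.

Theorem theorem26 (R : realType) (n : nat) (C : {set {set 'I_n}})
    (hC : convex_geometry C) :
  (realization (circuits_cone R (rooted_circuits C)) C /\
   realization (circuits_cone R (critical_circuits C)) C) /\
  (forall (U' : {set 'I_n}) (C' : {set {set 'I_n}}), ideal C U' C' ->
     realization (circuits_cone R (rooted_circuits C) `&`
                  positive_cone R (positive_circuits C')) C' /\
     realization (circuits_cone R (critical_circuits C) `&`
                  positive_cone R (positive_circuits C')) C').
Proof.
have sub := @circuits_cone_critical R n C.
split.
  split; (split; [exact: open_circuits_cone|exact: convex_circuits_cone|]) => X.
  - split=> [/(orthant_circuits_cone R hC)[x [xX xK _]]|[x [xX /sub xK]]].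
      by exists x.
    exact: critical_cone_orthant xX xK.
  - split=> [/(orthant_circuits_cone R hC)[x [xX /sub xK _]]|[x [xX xK]]].
      by exists x.
    exact: critical_cone_orthant xX xK.
move=> U' C' hI; have [C'C _ C'down] := hI.
have inC' X : X \in C' -> exists x : 'rV[R]_n, [/\ orthant X x,
    circuits_cone R (rooted_circuits C) x
    & positive_cone R (positive_circuits C') x].
  move=> XC'; have XC := fintype.subsetP C'C X XC'.
  have [x [xX xK xP]] := orthant_circuits_cone R hC XC.
  exists x; split=> // P; rewrite /= inE => /eqP trP; apply: xP.
  (* If [P] were contained in [X], then [P] itself would be a trace of [C'], which a positive
     circuit excludes. *)
  apply/negP => /finset.setIidPr XP.
  have : X :&: P \in trace_on C' P by exact: imset_f.
  by rewrite trP XP !inE eqxx.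
have meetC' X x : orthant X x -> circuits_cone R (critical_circuits C) x ->
    positive_cone R (positive_circuits C') x -> X \in C'.
  (* Convexity of [X] comes first, as an ideal is closed downward only among convex sets. *)
  move=> xX xK xP; have XC := critical_cone_orthant hC xX xK.
  apply/negPn/negP => XC'.
  have [Y YC'|P Ppos PX] := positive_circuit_sub hC hI (X := X).
    by apply: contra XC' => XY; exact: C'down XC YC' XY.
  have := xP P; rewrite /= => /(_ Ppos); apply/negP; rewrite -leNgt.
  apply: sumr_ge0 => e /(fintype.subsetP PX) eX.
  by have := xX e; rewrite eX => /ltW.
split; (split; [apply: openI; [exact: open_circuits_cone|exact: open_positive_cone]
  |apply: convex_setI; [exact: convex_circuits_cone|exact: convex_positive_cone]|])
  => X.
- split=> [/inC'[x [xX xK xP]]|[x [xX [/sub xK xP]]]]; first by exists x.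
  exact: meetC' xX xK xP.
- split=> [/inC'[x [xX /sub xK xP]]|[x [xX [xK xP]]]]; first by exists x.
  exact: meetC' xX xK xP.
Qed.
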